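(* Let $G=\mathbb{Z}_2*\mathbb{Z}_5$, where $\mathbb{Z}_2$ is generated by $\sigma$ and $\mathbb{Z}_5$ by $\tau$. Let $X=\{0,1\}^G$ with the product probability measure $m$ (each coordinate independently $0$ or $1$ with probability $\tfrac12$) on its Borel $\sigma$-algebra, and let $G$ act on $X$ by $(g(x))^h=x^{hg}$ for $g,h\in G$. Write $x^e$ for the coordinate of $x$ at the identity $e$. Consider the colouring rule with five colours $A_1,\dots,A_5$ (indices taken modulo $5$) and descendants $\tau^{-1}(x)$ and $\sigma(x)$ of $x$: if $\tau^{-1}(x)$ is coloured $A_i$, then $x$ must be coloured $A_{i+1}$ whenever at least one of the following holds: $x^e=1$; $\tau^{-1}(x)$ is coloured $A_5$; $\sigma(x)$ is coloured $A_1$. If none of these three conditions holds, then $x$ must be coloured $A_i$. Then this colouring rule is paradoxical.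
   Context: Setting: $(X,\mathcal F,m)$ is a probability space and the descendants $\phi_1,\dots,\phi_k:X\to X$ of a point are measurable, measure-preserving maps. A colouring rule prescribes, for each $x$ and each assignment of colours to the descendants $\phi_1(x),\dots,\phi_k(x)$, a nonempty set of allowed colours for $x$ (measurably in $x$). A colouring $c:X\to\{\text{colours}\}$ satisfies the rule if the set of $x$ for which $c(x)$ is not allowed given $c(\phi_1(x)),\dots,c(\phi_k(x))$ is contained in an $m$-null set. The rule is paradoxical if (i) some colouring (not necessarily measurable in any sense) satisfies it, and (ii) there is no finitely additive probability measure $\mu$, defined on an algebra of subsets of $X$ containing $\mathcal F$ and extending $m$, for which every descendant map is still measure preserving (for each $\mu$-measurable $S$, $\phi_i^{-1}(S)$ is $\mu$-measurable and $\mu(\phi_i^{-1}(S))=\mu(S)$), together with a colouring satisfying the rule all of whose colour classes are $\mu$-measurable. *)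

(* Defs.v *)
From HB Require Import structures.
From mathcomp Require Import all_boot all_order all_algebra all_fingroup finmap.
From mathcomp Require Import all_classical all_reals all_analysis.

Set Implicit Arguments.
Unset Strict Implicit.
Unset Printing Implicit Defensive.

Import Order.TTheory GRing.Theory Num.Theory.

Local Open Scope classical_set_scope.
Local Open Scope ring_scope.

Section FreeProduct.
Variables A B : groupType.
Local Open Scope group_scope.
Implicit Types (l : A + B) (w u v : seq (A + B)).

Definition nontrivial_letter l :=
  match l with inl a => a != 1 | inr b => b != 1 end.

Definition alternating l l' :=
  match l, l' with inl _, inr _ | inr _, inl _ => true | _, _ => false end.

Definition reduced w := all nontrivial_letter w && sorted alternating w.

(* Left multiplication of a reduced word by a (possibly trivial) letter. *)
Definition push l w :=
  match l, w with
  | inl a, inl a' :: w' => if a * a' == 1 then w' else inl (a * a') :: w'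
  | inr b, inr b' :: w' => if b * b' == 1 then w' else inr (b * b') :: w'
  | _, _ => if nontrivial_letter l then l :: w else w
  end.

Definition mulw u w := foldr push w u.

Definition inv_letter l : A + B :=
  match l with inl a => inl a^-1 | inr b => inr b^-1 end.

Definition invw w := rev (map inv_letter w).

Lemma reduced_nil : reduced [::]. Proof. by []. Qed.

Lemma reduced_tl l w : reduced (l :: w) -> reduced w.
Proof.
by case/andP=> /= /andP[_ aw] /path_sorted sw; apply/andP; split.
Qed.

Lemma reduced_push l w : reduced w -> reduced (push l w).
Proof.
case: w => [|[a'|b'] w]; case: l => [a|b] r /=; case: ifPn => // n.
- by rewrite /reduced /= n.
- by rewrite /reduced /= n.
- exact: reduced_tl r.
- by move: r; rewrite /reduced /= n => /andP[/andP[_ ->]]; case: w.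
- by move: r; rewrite /reduced /= n.
- by move: r; rewrite /reduced /= n.
- exact: reduced_tl r.
- by move: r; rewrite /reduced /= n => /andP[/andP[_ ->]]; case: w.
Qed.

Lemma reduced_mulw u w : reduced w -> reduced (mulw u w).
Proof. by move=> rw; elim: u => //= l u; exact: reduced_push. Qed.

Lemma push_cons l w : reduced (l :: w) -> push l w = l :: w.
Proof.
by case: l w => [a|b] [|[a'|b'] w] //=; rewrite /reduced /= ?andbF //
   => /andP[/andP[-> _] _].
Qed.

Lemma push_inl1 w : reduced w -> push (inl 1) w = w.
Proof.
case: w => [|[a|b] w] //=; rewrite ?eqxx //= mul1g.
by case/andP=> /= /andP[/negPf ->].
Qed.

Lemma push_inr1 w : reduced w -> push (inr 1) w = w.
Proof.
case: w => [|[a|b] w] //=; rewrite ?eqxx //= mul1g.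
by case/andP=> /= /andP[/negPf ->].
Qed.

Lemma push_inlM a a' w :
  reduced w -> push (inl a) (push (inl a') w) = push (inl (a * a')) w.
Proof.
have hyp v : reduced v -> ~~ (if v is inl _ :: _ then true else false) ->
    push (inl a) (push (inl a') v) = push (inl (a * a')) v.
  case: v => [|[//|b] v] rv _ /=.
  - by have [->|n] := eqVneq a' 1; rewrite ?mulg1 /=; case: ifP.
  - by have [->|n] := eqVneq a' 1; rewrite ?mulg1 /=; case: ifP.
case: w => [|[c|b] w] r; [exact: hyp| |exact: hyp].
rewrite /= -[a * a' * c]mulgA.
have [e|n] := eqVneq (a' * c) 1; last by [].
rewrite e mulg1.
case: w r => [|[d|b] w] // r; last by rewrite /=; case: eqVneq.
  by rewrite /=; case: eqVneq.
by case/andP: r.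
Qed.

Lemma push_inrM b b' w :
  reduced w -> push (inr b) (push (inr b') w) = push (inr (b * b')) w.
Proof.
have hyp v : reduced v -> ~~ (if v is inr _ :: _ then true else false) ->
    push (inr b) (push (inr b') v) = push (inr (b * b')) v.
  case: v => [|[a|//] v] rv _ /=.
  - by have [->|n] := eqVneq b' 1; rewrite ?mulg1 /=; case: ifP.
  - by have [->|n] := eqVneq b' 1; rewrite ?mulg1 /=; case: ifP.
case: w => [|[a|c] w] r; [exact: hyp|exact: hyp|].
rewrite /= -[b * b' * c]mulgA.
have [e|n] := eqVneq (b' * c) 1; last by [].
rewrite e mulg1.
case: w r => [|[a|d] w] // r; first by rewrite /=; case: eqVneq.
  by rewrite /=; case: eqVneq.
by case/andP: r.
Qed.

Lemma push_trivial l w : ~~ nontrivial_letter l -> reduced w -> push l w = w.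
Proof.
by case: l => [a|b] /negbNE/eqP ->; [exact: push_inl1|exact: push_inr1].
Qed.

Lemma push_alternating l w : sorted alternating (l :: w) ->
  push l w = if nontrivial_letter l then l :: w else w.
Proof. by case: l w => [a|b] [|[a'|b'] w]. Qed.

Lemma mulw_push l u w : reduced u -> reduced w ->
  mulw (push l u) w = push l (mulw u w).
Proof.
move=> ru rw; have rm := reduced_mulw u rw.
have [alt|] := boolP (sorted alternating (l :: u)).
  by rewrite push_alternating //; case: ifPn => // /push_trivial ->.
case: u ru {rm} => [//|l' u] ru nalt; have rm := reduced_mulw u rw.
have alt : sorted alternating (l' :: u) by case/andP: ru.
rewrite [mulw (l' :: u) w]/(push l' (mulw u w)).
case: l l' {ru} alt nalt => [a|b] [a'|b'] alt nalt;
  try by case/negP: nalt; exact: alt.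
- rewrite push_inlM // [push _ (_ :: _)]/=.
  by have [->|n] := eqVneq (a * a') 1; first by rewrite push_inl1.
- rewrite push_inrM // [push _ (_ :: _)]/=.
  by have [->|n] := eqVneq (b * b') 1; first by rewrite push_inr1.
Qed.

Lemma mulwA u v w : reduced u -> reduced v -> reduced w ->
  mulw u (mulw v w) = mulw (mulw u v) w.
Proof.
move=> + rv rw; elim: u => //= l u IH r.
by rewrite mulw_push ?IH ?(reduced_tl r) //; exact: reduced_mulw.
Qed.

Lemma mulw1 u : reduced u -> mulw u [::] = u.
Proof.
by elim: u => //= l u IH r; rewrite IH ?(reduced_tl r)// push_cons.
Qed.

Lemma reduced_inv w : reduced w -> reduced (invw w).
Proof.
rewrite /reduced /invw all_rev rev_sorted all_map => /andP[aw sw].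
apply/andP; split; first by apply: sub_all aw => -[a|b] /=; rewrite invg_eq1.
by rewrite sorted_map; apply: sub_sorted sw => -[a|b] [a'|b'].
Qed.

Lemma mulVw w : reduced w -> mulw (invw w) w = [::].
Proof.
suff E v : reduced w -> reduced (w ++ v) -> mulw (invw w) (w ++ v) = v.
  by move=> r; have := E [::]; rewrite cats0; apply.
elim: w => //= l w IH r rv.
rewrite /invw /= rev_cons -cats1 /mulw foldr_cat /=.
have -> : push (inv_letter l) (l :: w ++ v) = w ++ v.
  by case: l {r rv} => [a|b] /=; rewrite mulVg eqxx.
by apply: IH; [exact: reduced_tl r|exact: reduced_tl rv].
Qed.

Lemma invwK w : invw (invw w) = w.
Proof.
rewrite /invw map_rev revK -map_comp map_id_in // => -[a|b] _ /=;
by rewrite invgK.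
Qed.

(* The free product is realised by its normal forms: words of nontrivial letters
   taken alternately from A and B. *)
Record free_product := FreeProduct {
  fp_word : seq (A + B);
  fp_reduced : reduced fp_word }.

HB.instance Definition _ := [isSub for fp_word].
HB.instance Definition _ := [Choice of free_product by <:].

Definition fp_one := FreeProduct reduced_nil.
Definition fp_mul (x y : free_product) :=
  FreeProduct (reduced_mulw (fp_word x) (fp_reduced y)).
Definition fp_inv (x : free_product) := FreeProduct (reduced_inv (fp_reduced x)).

Lemma fp_mulA : associative fp_mul.
Proof. by move=> x y z; apply: val_inj; apply: mulwA; exact: fp_reduced. Qed.

Lemma fp_mul1 : left_id fp_one fp_mul.
Proof. by move=> x; exact: val_inj. Qed.

Lemma fp_mulr1 : right_id fp_one fp_mul.
Proof. by move=> x; apply: val_inj; apply: mulw1; exact: fp_reduced. Qed.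

Lemma fp_mulV : left_inverse fp_one fp_inv fp_mul.
Proof. by move=> x; apply: val_inj; apply: mulVw; exact: fp_reduced. Qed.

Lemma fp_mulrV : right_inverse fp_one fp_inv fp_mul.
Proof.
move=> x; have e : fp_inv (fp_inv x) = x by apply: val_inj; rewrite /= invwK.
by rewrite -[X in fp_mul X _]e fp_mulV.
Qed.

HB.instance Definition _ :=
  isGroup.Build free_product fp_mulA fp_mul1 fp_mulr1 fp_mulV fp_mulrV.

Definition fp_inl (a : A) := FreeProduct (reduced_push (inl a) reduced_nil).
Definition fp_inr (b : B) := FreeProduct (reduced_push (inr b) reduced_nil).

Lemma fp_inlM a a' : fp_inl (a * a') = fp_inl a * fp_inl a'.
Proof.
apply: val_inj; apply: etrans (esym (push_inlM a a' reduced_nil)) _.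
by apply/esym/mulw_push; [|exact: reduced_push].
Qed.

Lemma fp_inrM b b' : fp_inr (b * b') = fp_inr b * fp_inr b'.
Proof.
apply: val_inj; apply: etrans (esym (push_inrM b b' reduced_nil)) _.
by apply/esym/mulw_push; [|exact: reduced_push].
Qed.

End FreeProduct.

Definition shift_space (G : Type) : Type := prod_topology (fun _ : G => bool).

HB.instance Definition _ (G : Type) := Pointed.on (shift_space G).
HB.instance Definition _ (G : Type) := Topological.on (shift_space G).

Notation borel_shift_space G := (g_sigma_algebraType (@open (shift_space G))).

Definition coord_shift (G : groupType) (g : G) (x : borel_shift_space G) :
    borel_shift_space G :=
  fun h => x (h * g)%g.

(* The fair-coin product measure is the probability measure giving mass 2^-n
   to every cylinder that prescribes n coordinates. *)
Definition is_fair_coin_measure (R : realType) (G : groupType)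
    (m : probability (borel_shift_space G) R) : Prop :=
  forall (F : {fset G}) (b : G -> bool),
    m [set x | forall h, h \in F -> x h = b h] = ((2^-1) ^+ #|` F|)%:E.

Record colouring_rule (X C : Type) (k : nat) := ColouringRule {
  descendant : 'I_k -> X -> X;
  allowed : X -> ('I_k -> C) -> set C }.

Section Paradoxical.
Context {d : measure_display} {X : measurableType d} {R : realType}.
Variable m : probability X R.
Variables (C : finType) (k : nat).
Implicit Types (rule : colouring_rule X C k) (c : X -> C).

(* As C is finite, the last field says that [allowed rule ^~ a] is measurable
   as a map into the finite set of all subsets of C. *)
Record is_colouring_rule rule : Prop := IsColouringRule {
  descendant_measurable : forall i, measurable_fun setT (descendant rule i);
  descendant_preserving : forall i S, measurable S ->
    m (descendant rule i @^-1` S) = m S;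
  allowed_nonempty : forall x a, allowed rule x a !=set0;
  allowed_measurable : forall a col, measurable [set x | allowed rule x a col] }.

Definition satisfies rule c : Prop :=
  m.-negligible [set x | ~ allowed rule x (fun i => c (descendant rule i x)) (c x)].

Record finitely_additive_extension (alg : set (set X)) (mu : set X -> R) : Prop :=
  FinitelyAdditiveExtension {
  fae_setT : alg setT;
  fae_setring : setring alg;
  fae_ge0 : forall S, alg S -> 0 <= mu S;
  fae_mass1 : mu setT = 1;
  fae_additive : forall S T, alg S -> alg T -> S `&` T = set0 ->
    mu (S `|` T) = mu S + mu T;
  fae_measurable : measurable `<=` alg;
  fae_extends : forall S, measurable S -> (mu S)%:E = m S }.

Definition fa_measure_preserving (alg : set (set X)) (mu : set X -> R)
    (f : X -> X) : Prop :=
  forall S, alg S -> alg (f @^-1` S) /\ mu (f @^-1` S) = mu S.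

Definition paradoxical rule : Prop :=
  [/\ is_colouring_rule rule,
      exists c, satisfies rule c &
      ~ exists alg mu c,
        [/\ finitely_additive_extension alg mu,
            forall i, fa_measure_preserving alg mu (descendant rule i),
            satisfies rule c &
            forall col, alg (c @^-1` [set col])]].

End Paradoxical.

(* As groups, 'Z_2 and 'Z_5 are additive, with generator 1. *)
Definition G25 : groupType := free_product 'Z_2 'Z_5.
Definition sigma : G25 := fp_inl 'Z_5 (1%R : 'Z_2).
Definition tau : G25 := fp_inr 'Z_2 (1%R : 'Z_5).

(* The colour A_i is the residue of i in 'Z_5, so that A_5 is 0. *)
Definition rule25 : colouring_rule (borel_shift_space G25) 'Z_5 2 := {|
  descendant := fun i => if i == ord0 then coord_shift tau^-1%g else coord_shift sigma;
  allowed := fun x a =>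
    let i := a ord0 in
    if [|| x 1%g, i == 5%:R | a ord_max == 1%:R] then [set i + 1] else [set i] |}.

(* Main.v *)
(* Around a cycle x, tau x, .., tau^4 x the colour advances by 0 or 1 at each
   step, hence at every step or at none.

   No measurable colouring: let D be the union of the advancing cycles and W the
   set of points whose whole tau-cycle carries coordinates 0, of mass 1/32.  A
   point outside D lies in W, and tau permutes the sets B_i = A_i & D cyclically,
   so each has mass at most 1/5.  A point x of D with x^e = 0 has tau^-1 x in B_5
   or sigma x in A_1, and A_1 is contained in B_1 and W, so
   1/2 <= 1/5 + 1/5 + 2/32, which is false.

   A colouring without measurability: almost every orbit is free, hence a copy of
   G by a choice of base point.  Give A_1 to the words that do not start with a
   power of tau and A_(1+j) to those starting with tau^j.  Every step advances,
   because a point not coloured A_1 starts with a power of tau, and then its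
   sigma-neighbour is coloured A_1. *)
Require Import Defs.
From mathcomp Require Import all_boot all_order all_algebra all_fingroup finmap.
From mathcomp Require Import all_classical all_reals all_analysis.
From mathcomp Require Import zify lra.

Set Implicit Arguments.
Unset Strict Implicit.
Unset Printing Implicit Defensive.

Import Order.TTheory GRing.Theory Num.Theory.

Local Open Scope classical_set_scope.
Local Open Scope ring_scope.

(** * Cylinder sets, the Borel structure and the shift action *)

Section Cylinders.
Variable G : groupType.
Implicit Types (s t : seq (G * bool)) (x : borel_shift_space G).

Definition cyl s : set (borel_shift_space G) :=
  [set x | all (fun p => x p.1 == p.2) s].

Definition cylinders := [set cyl s | s in [set: seq (G * bool)]].

Lemma cyl_nil : cyl [::] = setT.
Proof. by apply/seteqP. Qed.

Lemma cyl_cat s t : cyl (s ++ t) = cyl s `&` cyl t.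
Proof.
apply/seteqP; split=> x; rewrite /cyl /= all_cat; first by move/andP.
by case=> -> ->.
Qed.

Lemma open_coord (h : G) b : open ([set x | x h = b] : set (shift_space G)).
Proof.
have /continuousP/(_ [set b]) :
  continuous (fun x : shift_space G => x h) := @proj_continuous G _ h.
by apply; exact: discrete_open.
Qed.

Lemma open_cyl s : open (cyl s : set (shift_space G)).
Proof.
elim: s => [|[h b] s IH]; first by rewrite cyl_nil; exact: openT.
rewrite -cat1s cyl_cat; apply: openI => //.
suff -> : cyl [:: (h, b)] = [set x | x h = b] by exact: open_coord.
by apply/seteqP; split=> x; rewrite /cyl /= andbT => /eqP.
Qed.

Lemma measurable_cyl s : measurable (cyl s).
Proof. by apply: sub_sigma_algebra; exact: open_cyl. Qed.

(** The supersets of cylinders around [x] form a filter. The product topology is the supremum of the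
    topologies pulled back along the coordinates, so convergence of this filter to [x] need only be
    tested one coordinate at a time. *)
Lemma nbhs_cyl (x : shift_space G) (A : set (shift_space G)) :
  nbhs x A -> exists2 s, cyl s x & cyl s `<=` A.
Proof.
pose F : set_system (shift_space G) :=
  [set B | exists2 s, cyl s x & cyl s `<=` B].
have FF : Filter F.
  split; first by exists [::].
  - move=> B C [s sx sB] [t tx tC]; exists (s ++ t); rewrite cyl_cat //.
    by move=> y [ys yt]; split; [exact: sB|exact: tC].
  - by move=> B C BC [s sx sB]; exists s => // y /sB /BC.
suff : F --> x by apply.
apply/(@cvg_sup _ _ _ F x FF) => h B [_ [[C _ <-]] Cx CB].
exists [:: (h, x h)]; first by rewrite /cyl /= eqxx.
by move=> y; rewrite /cyl /= andbT => /eqP yx; apply: CB => /=; rewrite yx.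
Qed.

Hypothesis cG : countable [set: G].

Lemma countable_cyl_index : countable [set: seq (G * bool)].
Proof.
have [f fI] := countable_injP _ cG.
apply/countable_injP.
exists (fun s => choice.pickle [seq (f p.1, p.2) | p <- s]).
move=> s t _ _ /(pcan_inj choice.pickleK) /inj_map; apply.
by move=> [g b] [h c] /= [/(fI _ _ (mem_set I) (mem_set I)) -> ->].
Qed.

(** Countability of [G] leaves only countably many cylinders, so every open set is a countable union
    of cylinders. *)
Lemma borel_cylinders :
  (measurable : set (set (borel_shift_space G))) = <<s cylinders >>.
Proof.
apply/seteqP; split; last first.
  apply: smallest_sub; first exact: sigma_algebra_measurable.
  by move=> _ [s _ <-]; exact: measurable_cyl.
apply: smallest_sub; first exact: smallest_sigma_algebra.
move=> U oU.
(* The union runs over all finite prescriptions; those whose cylinder is not inside [U] contribute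
   [set0]. *)
have -> : U = \bigcup_s (if `[< cyl s `<=` U >] then cyl s else set0).
  apply/seteqP; split=> [x Ux|x [s _]]; last by case: asboolP => // sU /sU.
  have [s sx sU] := nbhs_cyl (open_nbhs_nbhs (conj oU Ux)).
  by exists s => //; case: asboolP.
apply: (@countable_bigcupT_measurable _ (g_sigma_algebraType cylinders) _ _
  countable_cyl_index) => s.
by case: asboolP => _; [apply: sub_sigma_algebra; exists s|exact: measurable0].
Qed.

Variables (R : realType) (m : probability (borel_shift_space G) R).
Hypothesis hm : is_fair_coin_measure m.

Lemma coord_shift_cyl (g : G) s :
  coord_shift g @^-1` cyl s = cyl [seq (p.1 * g, p.2)%g | p <- s].
Proof. by apply/seteqP; split=> x; rewrite /cyl /= all_map. Qed.

Lemma measurable_coord_shift (g : G) :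
  measurable_fun setT
    (coord_shift g : borel_shift_space G -> borel_shift_space G).
Proof.
apply: (measurability _ borel_cylinders) => _ [_ [s _ <-] <-].
by rewrite setTI coord_shift_cyl; exact: measurable_cyl.
Qed.

(** The list may repeat a coordinate or contradict itself. Nonemptiness excludes contradictions, and
    a point of the cylinder supplies the prescribed values, so only the distinct coordinates
    count. *)
Lemma fair_coin_cyl s : cyl s !=set0 ->
  m (cyl s) = ((2^-1) ^+ #|` [fset h in unzip1 s]%fset|)%:E.
Proof.
case=> x /allP sx; rewrite -(hm _ x); congr (m _).
apply/seteqP; split=> y => [/allP sy h|sy].
  by rewrite inE /= => /mapP[p ps ->]; rewrite (eqP (sx _ ps)) (eqP (sy _ ps)).
apply/allP => p ps; rewrite -(eqP (sx _ ps)); apply/eqP/sy.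
by rewrite inE /= map_f.
Qed.

(** Cylinders form a generating family closed under intersection, so it suffices to compare masses
    there. Right multiplication by [g] is injective, hence keeps the number of distinct
    coordinates. *)
Lemma coord_shift_preserving (g : G) (S : set (borel_shift_space G)) :
  measurable S -> m (coord_shift g @^-1` S) = m S.
Proof.
move=> mS; have mg := measurable_coord_shift g.
apply: (measure_unique cylinders (fun=> setT) borel_cylinders _ _ _
  (distribution m (mfun_Sub (mem_set mg))) m) => //.
- by move=> _ _ [s _ <-] [t _ <-]; exists (s ++ t); rewrite ?cyl_cat.
- by move=> _; exists [::]; rewrite ?cyl_nil.
- by rewrite bigcup_const.
- move=> _ [s _ <-]; transitivity (m (coord_shift g @^-1` cyl s)); first by [].
  rewrite coord_shift_cyl.
  have [s0|/set0P[x sx]] := eqVneq (cyl s) set0.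
    by rewrite -coord_shift_cyl s0 preimage_set0.
  rewrite [RHS]fair_coin_cyl; last by exists x.
  rewrite fair_coin_cyl; last first.
    exists (coord_shift g^-1%g x); rewrite -coord_shift_cyl /=.
    by congr (cyl s _): sx; apply/funext => h; rewrite /coord_shift mulgK.
  congr (_ ^+ _)%:E.
  have -> : unzip1 [seq (p.1 * g, p.2)%g | p <- s] =
      [seq (h * g)%g | h <- unzip1 s].
    by rewrite /unzip1 -!map_comp.
  by rewrite !card_fseq (undup_map_inj (mulIg g)) size_map.
- by move=> k /=; rewrite (le_lt_trans (probability_le1 _ _)) ?ltry.
Qed.

Lemma coord_shiftM (g h : G) x :
  coord_shift g (coord_shift h x) = coord_shift (g * h)%g x.
Proof. by apply/funext => k; rewrite /coord_shift mulgA. Qed.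

Lemma coord_shift1 x : coord_shift 1%g x = x.
Proof. by apply/funext => k; rewrite /coord_shift mulg1. Qed.

Lemma fair_coin_uniq s : uniq (unzip1 s) ->
  m (cyl s) = ((2^-1) ^+ size s)%:E.
Proof.
move=> us; rewrite fair_coin_cyl ?card_fseq ?undup_id ?size_map //.
(* A point of the cylinder: values are read off [s], and are [true] at coordinates not listed. *)
exists (fun h => nth true (unzip2 s) (index h (unzip1 s))).
elim: s us => [|[h b] s IH] //= /andP[hs us]; rewrite /cyl /= eqxx eqxx /=.
apply/allP => -[k c] /= ks; have := allP (IH us) _ ks; rewrite /=.
by case: (eqVneq h k) hs => // -> /negP[]; exact: (map_f fst ks).
Qed.

(** * Almost every orbit is free *)

Definition periodic_on (g : G) (hs : seq G) : set (borel_shift_space G) :=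
  [set x | all (fun h => x (h * g)%g == x h) hs].

Lemma periodic_on_cons (g h : G) hs :
  periodic_on g (h :: hs) = (cyl [:: (h, true); (h * g, true)%g] `|`
    cyl [:: (h, false); (h * g, false)%g]) `&` periodic_on g hs.
Proof.
apply/seteqP; split=> x; rewrite /cyl /periodic_on /=.
  by case/andP=> /eqP -> ->; split=> //; case: (x h); [left|right].
by case=> -[/and3P[/eqP -> /eqP -> _] ->|/and3P[/eqP -> /eqP -> _] ->].
Qed.

Lemma measurable_periodic_on (g : G) hs : measurable (periodic_on g hs).
Proof.
elim: hs => [|h hs IH].
  by rewrite (_ : periodic_on _ _ = setT) //; apply/seteqP.
rewrite periodic_on_cons; apply: measurableI => //.
by apply: measurableU; exact: measurable_cyl.
Qed.

(* Each step fixes one more coordinate pair (h, h g): two of its four cylinders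
   remain, so the mass is halved. *)
Lemma fair_coin_periodic_on (g : G) (hs : seq G) s :
  uniq (hs ++ [seq (h * g)%g | h <- hs] ++ unzip1 s) ->
  (m (cyl s `&` periodic_on g hs) <= ((2^-1) ^+ (size hs + size s))%:E)%E.
Proof.
elim: hs s => [|h hs IH] s u.
  rewrite (_ : periodic_on _ _ = setT) ?setIT; last exact/seteqP.
  by rewrite fair_coin_uniq.
pose s' b := [:: (h, b), (h * g, b)%g & s].
have -> : cyl s `&` periodic_on g (h :: hs) =
    (cyl (s' true) `&` periodic_on g hs) `|`
    (cyl (s' false) `&` periodic_on g hs).
  have s'E b : cyl (s' b) = cyl [:: (h, b); (h * g, b)%g] `&` cyl s.
    by rewrite -cyl_cat.
  by rewrite periodic_on_cons !s'E -setIUl -setIUl setIA (setIC (cyl s)).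
have le b : (m (cyl (s' b) `&` periodic_on g hs) <=
    ((2^-1) ^+ (size hs + size s).+2)%:E)%E.
  rewrite -!addnS; apply: IH; rewrite -(@perm_uniq _ (h :: hs ++ (h * g)%g ::
    [seq (h * g)%g | h <- hs] ++ unzip1 s)) //; apply/seq.permP => a.
  by rewrite /= !count_cat /= !count_cat /=; lia.
have mI b : measurable (cyl (s' b) `&` periodic_on g hs).
  by apply: measurableI; [exact: measurable_cyl|exact: measurable_periodic_on].
apply: le_trans (measureU2 _ _ _) _ => //.
apply: le_trans (leeD (le _) (le _)) _.
by rewrite -EFinD lee_fin exprS -mulrDl -[X in X + X]mul1r -splitr mul1r.
Qed.

Hypothesis iG : infinite_set [set: G].

(** An infinite group contains [n] pairwise disjoint pairs [h], [h * g] for every [n]. A fixed point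
    agrees on both members of each pair, an event of mass at most [2^-n]. *)
Lemma periodic_negligible (g : G) : g != 1%g ->
  m.-negligible [set x | coord_shift g x = x].
Proof.
move=> g1.
have ex n : exists hs, size hs = n /\ uniq (hs ++ [seq (h * g)%g | h <- hs]).
  elim: n => [|n [hs [sz u]]]; first by exists [::].
  pose l := hs ++ [seq (h * g)%g | h <- hs].
  (* Avoiding [l] and its translate by [g^-1] keeps both [h] and [h * g] out of [l]. *)
  have [h [_ hl]] :
      ([set: G] `\` [set` l ++ [seq (h * g^-1)%g | h <- l]]) !=set0.
    exact/infinite_setN0/infinite_setD/finite_seq.
  exists (h :: hs); split; first by rewrite /= sz.
  have {hl} : h \notin l ++ [seq (h * g^-1)%g | h <- l] by apply/negP.
  rewrite mem_cat negb_or => /andP[hl hgl].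
  have {}hgl : (h * g)%g \notin l.
    by apply: contra hgl => hgl; apply/mapP; exists (h * g)%g; rewrite ?mulgK.
  rewrite (_ : uniq _ = uniq (h :: (h * g)%g :: l)); last first.
    by apply/perm_uniq/seq.permP => a; rewrite /l /= !count_cat /=; lia.
  by rewrite /= hgl u inE negb_or hl -{1}[h]mulg1 (inj_eq (mulgI h)) eq_sym g1.
have [f fP] := choice ex.
have mB : measurable (\bigcap_n periodic_on g (f n)).
  by apply: bigcapT_measurable => n; exact: measurable_periodic_on.
exists (\bigcap_n periodic_on g (f n)); split => //; last first.
  by move=> x gx n _; apply/allP => h _; rewrite -{2}gx.
apply/eqP; rewrite -measure_le0; apply/lee_addgt0Pr => e e0.
have [n ne] : exists n, (2^-1 : R) ^+ n < e.
  have /cvgr0_norm_lt/(_ _ e0)[n _ ne] :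
      (fun n => (2^-1 : R) ^+ n) n @[n --> \oo] --> 0.
    by apply: cvg_expr; rewrite ger0_norm ?invr_ge0 // invf_lt1 ?ltr1n.
  by exists n; rewrite (le_lt_trans (ler_norm _)) ?ne /=.
have [sz u] := fP n.
have := @fair_coin_periodic_on g (f n) [::].
rewrite cats0 cyl_nil setTI /= addn0 sz add0e => /(_ u) le.
apply: le_trans (le_trans le _); last by rewrite lee_fin ltW.
apply: le_measure; rewrite ?inE //; first exact: measurable_periodic_on.
exact: bigcap_inf.
Qed.
Definition aperiodic x := forall g : G, coord_shift g x = x -> g = 1%g.

Lemma aperiodic_ae : m.-negligible (~` aperiodic).
Proof.
have [f fI] := countable_injP _ cG.
(* Group elements are indexed by their codes under the injection [f]; a number that codes no
   nontrivial element gives an empty set. *)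
pose F n := [set x | exists g : G,
  [/\ f g = n, g <> 1%g & coord_shift g x = x]].
apply: (@negligibleS _ _ _ _ (\bigcup_n F n)).
  move=> x /existsNP[g /not_implyP[gx g1]].
  by exists (f g) => //; exists g.
apply: negligible_bigcup => n.
have [[g [fg g1]]|no] := pselect (exists g, f g = n /\ g <> 1%g); last first.
  apply: (negligibleS _ (negligible_set0 _)) => x [g [fg g1 _]].
  by apply: no; exists g.
apply: (negligibleS _ (@periodic_negligible g _)); last exact/eqP.
move=> x [h [fh _ hx]]; rewrite -fh in fg.
by rewrite /= (fI g h) ?inE.
Qed.
End Cylinders.

(** * Size of the group, and a colouring of its words *)

Lemma countable_G25 : countable [set: G25].
Proof.
apply/countable_injP; exists (fun g : G25 => choice.pickle (fp_word g)).
by move=> g h _ _ /(pcan_inj choice.pickleK) /val_inj.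
Qed.

Fixpoint alternating_word (b : bool) (n : nat) : seq ('Z_2 + 'Z_5) :=
  if n is n'.+1 then
    (if b then inl 1%R else inr 1%R) :: alternating_word (~~ b) n'
  else [::].

Lemma reduced_alternating_word b n : reduced (alternating_word b n).
Proof.
elim: n b => [|n IH] b //; have /andP[an sn] := IH (~~ b).
rewrite /reduced /= an andbT; apply/andP; split; first by case: b {an sn}.
by case: n {IH an} sn => [|n] //= ->; case: b.
Qed.

Lemma infinite_G25 : infinite_set [set: G25].
Proof.
move=> /(finite_image (fun g : G25 => size (fp_word g))) fin.
apply: infinite_nat; apply: sub_finite_set fin => n _.
exists (FreeProduct (reduced_alternating_word true n)) => //=.
by elim: n true => //= n IH b; rewrite IH.
Qed.

(* On a free orbit the colour advances along every tau-step, and the coset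
   representatives not starting with a power of tau get the colour A_1. *)
Definition word_colour (w : seq ('Z_2 + 'Z_5)) : 'Z_5 :=
  if w is inr j :: _ then 1 + j else 1.

Lemma word_colour_tau (g : G25) :
  word_colour (fp_word (tau * g)%g) = word_colour (fp_word g) + 1.
Proof.
case: g => [[|[a|b] w] rw] //=; rewrite (_ : (_ * _)%g = 1 + b) //.
(* If [tau] cancels the leading power, reducedness prevents the remainder from starting with another
   power of [tau], so its colour is 1. *)
case: eqVneq => [b1|_] /=; last by rewrite addrA addrAC.
rewrite b1 add0r; case: w rw => [|[a|b'] w] //.
by rewrite /reduced /= andbF.
Qed.

Lemma word_colour_tauV (g : G25) :
  word_colour (fp_word (tau^-1 * g)%g) = word_colour (fp_word g) - 1.
Proof. by rewrite -{2}[g](mulKVg tau) word_colour_tau addrK. Qed.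

(** A colour other than 1 forces a leading power of [tau], so [sigma] is prepended without
    cancellation. *)
Lemma word_colour_sigma (g : G25) : word_colour (fp_word g) != 1 ->
  word_colour (fp_word (sigma * g)%g) = 1.
Proof. by case: g => [[|[a|b] w] rw]. Qed.

(** * Base points of orbits and the non-measurable colouring *)

Section OrbitWord.
Variable G : groupType.
Implicit Types x : borel_shift_space G.

Definition orbit_of x : set (borel_shift_space G) :=
  [set y | exists g, x = coord_shift g y].

Definition orbit_rep x := get (orbit_of x).

Definition orbit_word x := xget 1%g [set g | x = coord_shift g (orbit_rep x)].

Lemma orbit_wordK x : coord_shift (orbit_word x) (orbit_rep x) = x.
Proof.
have [g xg] : orbit_of x (orbit_rep x).
  by apply: (@getI _ _ x); exists 1%g; rewrite coord_shift1.
exact: esym (xgetI 1%g (xg : [set g | x = coord_shift g (orbit_rep x)] g)).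
Qed.

(** The base point is chosen from the orbit as a set, and both points have the same orbit. *)
Lemma orbit_rep_shift (g : G) x : orbit_rep (coord_shift g x) = orbit_rep x.
Proof.
congr get; apply/seteqP; split=> y [h e].
  by exists (g^-1 * h)%g; rewrite -coord_shiftM -e coord_shiftM mulVg
    coord_shift1.
by exists (g * h)%g; rewrite -coord_shiftM -e.
Qed.

(** Both elements carry the base point to the same point; freeness makes such an element unique. *)
Lemma orbit_word_shift (g : G) x : aperiodic x ->
  orbit_word (coord_shift g x) = (g * orbit_word x)%g.
Proof.
move=> ax; have := orbit_wordK (coord_shift g x).
rewrite orbit_rep_shift; set k := orbit_word _ => e.
apply: (mulgI g^-1%g); rewrite mulKg; apply: (mulIg (orbit_word x)^-1%g).
rewrite mulgV; apply: ax.
have := congr1 (coord_shift (orbit_word x)^-1%g) (orbit_wordK x).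
rewrite coord_shiftM mulVg coord_shift1 => r.
by rewrite -coord_shiftM -r -coord_shiftM e coord_shiftM mulVg coord_shift1.
Qed.
End OrbitWord.

Definition orbit_colouring (x : borel_shift_space G25) : 'Z_5 :=
  word_colour (fp_word (orbit_word x)).

Lemma orbit_colouring_allowed x : aperiodic x ->
  allowed rule25 x (fun i => orbit_colouring (descendant rule25 i x))
    (orbit_colouring x).
Proof.
move=> ax; rewrite /= /orbit_colouring !orbit_word_shift //.
rewrite word_colour_tauV; case: ifP => [_|/negbT]; first by rewrite /= subrK.
(* Not advancing is impossible: by [c0] the point itself does not have colour 1, so its
   [sigma]-neighbour has, against [c1]. *)
rewrite !negb_or => /and3P[_ c0 c1]; case/negP: c1; apply/eqP.
apply: word_colour_sigma; apply: contra c0 => /eqP ->.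
by rewrite subrr.
Qed.

(** * Finitely additive measures on an algebra of sets *)

Section FinitelyAdditive.
Context {d : measure_display} {X : measurableType d} {R : realType}.
Variables (m : probability X R) (alg : set (set X)) (mu : set X -> R).
Hypothesis fae : finitely_additive_extension m alg mu.
Implicit Types A B : set X.

Lemma fae_alg0 : alg set0.
Proof. by case: (fae_setring fae). Qed.

Lemma fae_algU A B : alg A -> alg B -> alg (A `|` B).
Proof. by case: (fae_setring fae) => _ U _; exact: U. Qed.

Lemma fae_algD A B : alg A -> alg B -> alg (A `\` B).
Proof. by case: (fae_setring fae) => _ _ D; exact: D. Qed.

Lemma fae_algI A B : alg A -> alg B -> alg (A `&` B).
Proof. by move=> aA aB; rewrite -setDD; do ?apply: fae_algD. Qed.

Lemma fae_le A B : alg A -> alg B -> A `<=` B -> mu A <= mu B.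
Proof.
move=> aA aB AB; rewrite -(setUIDK B A) (setIidr AB).
rewrite (fae_additive fae) ?setDIK // ?lerDl ?(fae_ge0 fae) //; exact: fae_algD.
Qed.

Lemma fae_leU A B : alg A -> alg B -> mu (A `|` B) <= mu A + mu B.
Proof.
move=> aA aB; have aBA := fae_algD aB aA.
have -> : A `|` B = A `|` (B `\` A) by rewrite setUDr setDv setD0.
by rewrite (fae_additive fae) ?setDIK // lerD2l; apply: fae_le => // x [].
Qed.

Lemma fae_set0 : mu set0 = 0.
Proof.
have := fae_additive fae fae_alg0 fae_alg0 (setI0 _).
by rewrite setU0 => /esym/eqP; rewrite -subr_eq0 addrK => /eqP.
Qed.

Lemma set_exists_nil (I : eqType) (A : I -> set X) :
  [set x | exists2 i, i \in [::] & A i x] = set0.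
Proof. by apply/seteqP; split=> x // []. Qed.

Lemma set_exists_cons (I : eqType) i s (A : I -> set X) :
  [set x | exists2 j, j \in i :: s & A j x] =
  A i `|` [set x | exists2 j, j \in s & A j x].
Proof.
apply/seteqP; split=> x => [[j]|[Ax|[j js Ax]]].
- by rewrite inE => /orP[/eqP ->|js] Ax; [left|right; exists j].
- by exists i => //; rewrite mem_head.
- by exists j => //; rewrite inE js orbT.
Qed.

Lemma fae_alg_exists (I : eqType) (s : seq I) (A : I -> set X) :
  (forall i, alg (A i)) -> alg [set x | exists2 i, i \in s & A i x].
Proof.
move=> aA; elim: s => [|i s IH].
  by rewrite set_exists_nil; exact: fae_alg0.
by rewrite set_exists_cons; exact: fae_algU.
Qed.

Lemma fae_alg_forall (I : eqType) (s : seq I) (A : I -> set X) :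
  (forall i, alg (A i)) -> alg [set x | forall i, i \in s -> A i x].
Proof.
move=> aA.
rewrite (_ : [set x | _] =
  setT `\` [set x | exists2 i, i \in s & (setT `\` A i) x]).
  apply: fae_algD; first exact: fae_setT fae.
  by apply: fae_alg_exists => i; apply: fae_algD; [exact: fae_setT fae|].
apply/seteqP; split=> [x xA|x [_ xA] i si].
  by split=> // -[i si [_]]; apply; exact: xA.
by apply: contrapT => nA; apply: xA; exists i.
Qed.

Lemma fae_null_exists (I : eqType) (s : seq I) (A : I -> set X) :
  (forall i, alg (A i)) -> (forall i, mu (A i) = 0) ->
  mu [set x | exists2 i, i \in s & A i x] = 0.
Proof.
move=> aA A0; elim: s => [|i s IH]; first by rewrite set_exists_nil fae_set0.
have aE : alg [set x | exists2 j, j \in s & A j x] by exact: fae_alg_exists.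
apply/eqP; rewrite set_exists_cons eq_le (fae_ge0 fae) ?andbT;
  last exact: fae_algU.
by apply: le_trans (fae_leU _ _) _ => //; rewrite A0 IH addr0.
Qed.

Lemma fae_sum_fibers (I : eqType) (s : seq I) (f : X -> I) A : uniq s ->
  (forall i, alg (A `&` f @^-1` [set i])) ->
  \sum_(i <- s) mu (A `&` f @^-1` [set i]) <= 1.
Proof.
move=> us aA; have aE t := fae_alg_exists t aA.
suff -> : \sum_(i <- s) mu (A `&` f @^-1` [set i]) =
    mu [set x | exists2 i, i \in s & (A `&` f @^-1` [set i]) x].
  by rewrite -(fae_mass1 fae); apply: fae_le => //; exact: fae_setT fae.
elim: s us => [_|i s IH /= /andP[si us]].
  by rewrite big_nil set_exists_nil fae_set0.
rewrite big_cons IH // set_exists_cons (fae_additive fae) //; first exact: aA.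
by apply/seteqP; split=> x // [[_ /= fi]] [j js [_ /= fj]];
  move: si; rewrite -fi fj js.
Qed.

Lemma fae_iter_preserving (f : X -> X) n :
  fa_measure_preserving alg mu f -> fa_measure_preserving alg mu (iter n f).
Proof.
move=> fP; elim: n => [|n IH] A aA //.
have [aA' mA'] := fP A aA; have [aA'' mA''] := IH _ aA'.
by rewrite -[mu A]mA' -mA''.
Qed.

(** * The mass bound for a measurable colouring *)

Section Bound.
Variables (T S : X -> X) (e : X -> bool) (c : X -> 'Z_5) (Z : set X).
Hypothesis TP : fa_measure_preserving alg mu T.
Hypothesis SP : fa_measure_preserving alg mu S.
Hypothesis T5 : forall x, iter 5 T x = x.
Hypothesis eP : alg [set x | ~~ e x].
Hypothesis cP : forall i, alg (c @^-1` [set i]).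
Hypothesis aZ : alg Z.
Hypothesis Z0 : mu Z = 0.

Let advance x := [|| e x, c (T x) == 0 | c (S x) == 1].
Hypothesis rule : forall x, ~ Z x -> c x = c (T x) + (advance x)%:R.

(** Off [Z'] the rule holds along the whole [T]-cycle. The sets [Z'], [W] and [D] are written as
    finite unions or intersections so that membership in [alg] follows from its closure
    properties. *)
Let Z' := [set x | exists2 j, j \in iota 0 5 & (iter j T @^-1` Z) x].
Let W := [set x | forall j, j \in iota 0 5 ->
  (iter j T @^-1` [set x | ~~ e x]) x].
Let D := [set x | exists2 i, i \in enum 'Z_5 &
  (c @^-1` [set i + 1] `&` T @^-1` (c @^-1` [set i])) x].

Let inD x : D x <-> c x = c (T x) + 1.
Proof.
split; first by case=> i _ [-> ->].
by move=> cx; exists (c (T x)) => //; rewrite mem_enum.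
Qed.

(* The number of advances around a tau-cycle is divisible by 5: it is 0 or 5. *)
Let advance_const x j : ~ Z' x -> (j < 5)%N -> advance (iter j T x) = advance x.
Proof.
move=> nZ; have r k : (k < 5)%N ->
    c (iter k T x) = c (iter k.+1 T x) + (advance (iter k T x))%:R.
  move=> k5; apply: rule => Zk; apply: nZ; exists k => //.
  by rewrite mem_iota.
have := r 0%N isT; rewrite (r 1%N) // (r 2%N) // (r 3%N) // (r 4%N) // T5.
rewrite -!addrA -{1}[c (iter 0 T x)]addr0 => /addrI /= sum0 j5.
suff : [/\ advance (T x) = advance x, advance (T (T x)) = advance x,
    advance (T (T (T x))) = advance x & advance (T (T (T (T x)))) = advance x].
  by case=> a1 a2 a3 a4; case: j j5 => [|[|[|[|[|]]]]].
move: sum0; case: (advance x); case: (advance (T x)); case: (advance (T (T x)));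
  case: (advance (T (T (T x)))); case: (advance (T (T (T (T x))))) => //.
Qed.

Let D_advance x : ~ Z x -> D x <-> advance x.
Proof.
move=> /rule; rewrite inD => ->; split=> [/addrI|->//].
by case: (advance x).
Qed.
Let Z'Z x : ~ Z' x -> ~ Z x.
Proof. by move=> nZ Zx; apply: nZ; exists 0%N. Qed.

Let Z'TZ x : ~ Z' x -> ~ Z (T x).
Proof. by move=> nZ Zx; apply: nZ; exists 1%N. Qed.

Let D_T x : ~ Z' x -> D (T x) <-> D x.
Proof.
move=> nZ; rewrite (D_advance (Z'TZ nZ)) (D_advance (Z'Z nZ)).
by rewrite (@advance_const x 1%N).
Qed.

Let W_notD x : ~ Z' x -> ~ D x -> W x.
Proof.
move=> nZ; rewrite (D_advance (Z'Z nZ)) => /negP na j.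
rewrite mem_iota => j5 /=; rewrite -(advance_const nZ j5) in na.
by move: na; rewrite !negb_or => /and3P[].
Qed.

Let aZ' : alg Z'.
Proof.
by apply: fae_alg_exists => j; have [] := fae_iter_preserving j TP aZ.
Qed.

Let Z'0 : mu Z' = 0.
Proof.
apply: fae_null_exists => j; have [] := fae_iter_preserving j TP aZ => //.
by move=> _ ->.
Qed.

Let aW : alg W.
Proof.
by apply: fae_alg_forall => j; have [] := fae_iter_preserving j TP eP.
Qed.

Let aD : alg D.
Proof.
apply: fae_alg_exists => i; apply: fae_algI => //.
by have [] := TP (cP i).
Qed.

Let B i := D `&` c @^-1` [set i].

Let aB i : alg (B i).
Proof. exact: fae_algI. Qed.

(** [D] is [T]-invariant off [Z'], so the preimage of [B i] under [T] lies in [B (i + 1)] up to the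
    null set [Z']. *)
Let B_le i : mu (B i) <= mu (B (i + 1)).
Proof.
have [aTB <-] := TP (aB i).
rewrite -[leRHS]addr0 -Z'0; apply: le_trans (fae_leU _ _) => //.
apply: fae_le => //; first exact: fae_algU.
move=> x [DTx /= cTx]; have [Zx|nZx] := pselect (Z' x); [by right|left].
have Dx : D x by apply/(D_T nZx).
by split=> //=; move/inD: Dx => ->; rewrite cTx.
Qed.

Let B_bound i : mu (B i) <= 5^-1.
Proof.
(* Listed from [i] onwards the five masses are nondecreasing, so five times the first is at most
   their sum, which is at most 1. *)
pose s := [:: i; i + 1; i + 1 + 1; i + 1 + 1 + 1; i + 1 + 1 + 1 + 1].
have us : uniq s by case: i @s => -[|[|[|[|[|//]]]]].
have := fae_sum_fibers us aB; rewrite !big_cons big_nil.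
have := B_le i; have := B_le (i + 1); have := B_le (i + 1 + 1).
have := B_le (i + 1 + 1 + 1).
by rewrite -!/(B _); lra.
Qed.

Lemma advance_bound : mu [set x | ~~ e x] <= 5^-1 *+ 2 + mu W *+ 2.
Proof.
have [aTB mTB] := TP (aB 0); have [aSB mSB] := SP (aB 1).
have [aSW mSW] := SP aW; have [aSZ mSZ] := SP aZ'.
(* Off the null sets, a point outside [D] is in [W]. A point of [D] advances because [T x] has
   colour 0, and then [T x] is in [B 0], or because [S x] has colour 1, and then [S x] is in [B 1]
   or in [W]. *)
have cover : [set x | ~~ e x] `<=` T @^-1` B 0 `|` (S @^-1` B 1 `|`
    (W `|` (S @^-1` W `|` (Z' `|` S @^-1` Z')))).
  move=> x /= ex; have [Zx|nZx] := pselect (Z' x); first by do 4!right; left.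
  have [Sx|nSx] := pselect (Z' (S x)); first by do 5!right.
  have [Dx|nDx] := pselect (D x); last by do 2!right; left; exact: W_notD.
  have /D_advance/proj1/(_ Dx) := Z'Z nZx.
  rewrite /advance (negPf ex) /= => /orP[/eqP cT|/eqP cS].
    by left; split=> //; apply/(D_T nZx).
  have [DSx|nDSx] := pselect (D (S x)); first by right; left.
  by do 3!right; left; exact: W_notD.
have a5 := fae_algU aZ' aSZ; have a4 := fae_algU aSW a5.
have a3 := fae_algU aW a4; have a2 := fae_algU aSB a3.
have := fae_le eP (fae_algU aTB a2) cover.
have := fae_leU aTB a2; have := fae_leU aSB a3; have := fae_leU aW a4.
have := fae_leU aSW a5; have := fae_leU aZ' aSZ.
rewrite mTB mSB mSW mSZ Z'0; have := B_bound 0; have := B_bound 1.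
by rewrite !mulr2n; lra.
Qed.
End Bound.
End FinitelyAdditive.

(** * The rule for [sigma] and [tau], and the conclusion *)

Lemma sigma_tau_is_colouring_rule (R : realType)
  (m : probability (borel_shift_space G25) R) :
  is_fair_coin_measure m -> is_colouring_rule m rule25.
Proof.
move=> hm; split.
- by move=> i /=; case: ifP => _; exact: (measurable_coord_shift countable_G25).
- move=> i S mS /=.
  by case: ifP => _; exact: (coord_shift_preserving countable_G25 hm).
- by move=> x a /=; case: ifP => _; eexists; reflexivity.
- move=> a col /=.
  (* With [a] and [col] fixed, the condition depends on [x] only through its coordinate at the
     identity. *)
  have -> : [set x : borel_shift_space G25 |
      (if [|| x 1%g, a ord0 == 5%:R | a ord_max == 1%:R]
       then [set a ord0 + 1] else [set a ord0]) col] =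
    (cyl [:: (1%g, true)] `&` [set _ | col = a ord0 + 1]) `|`
    (cyl [:: (1%g, false)] `&` [set _ |
      col = a ord0 + ((a ord0 == 5%:R) || (a ord_max == 1%:R))%:R]).
    apply/seteqP; split=> x; rewrite /cyl /= !andbT.
      case: (x 1%g) => /=; first by left.
      by case: ifP => _ xc; right; rewrite ?addr0.
    case: (x 1%g) => /= -[[//] _ ->|[//] _ ->] //.
    by case: ifP; rewrite ?addr0.
  have mcst (P : Prop) : measurable [set _ : borel_shift_space G25 | P].
    have [p|np] := pselect P.
      by rewrite (_ : [set _ | _] = setT) //; apply/seteqP; split.
    by rewrite (_ : [set _ | _] = set0) //; apply/seteqP; split.
  by apply: measurableU; apply: measurableI => //; exact: measurable_cyl.
Qed.

Lemma iter_coord_shift (G : groupType) (g : G) j x :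
  iter j (coord_shift g) x = coord_shift (g ^+ j)%g x.
Proof.
elim: j => [|j IH]; first by rewrite expg0 coord_shift1.
by rewrite iterS IH coord_shiftM expgS.
Qed.

(** Ensures that the cylinder [W] prescribes five distinct coordinates and so has mass 1/32. *)
Lemma uniq_tau_powers : uniq [seq (tau^-1 ^+ j)%g | j <- iota 0 5].
Proof. by vm_compute. Qed.

Lemma tauV_expg5 : (tau^-1 ^+ 5)%g = 1%g.
Proof. exact/val_inj. Qed.

Theorem theorem1 (R : realType) (m : probability (borel_shift_space G25) R)
  (hm : is_fair_coin_measure m) : paradoxical m rule25.
Proof.
split; first exact: sigma_tau_is_colouring_rule.
  exists orbit_colouring.
  apply: negligibleS (aperiodic_ae countable_G25 hm infinite_G25) => x /=.
  by apply: contra_not; exact: orbit_colouring_allowed.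
case=> alg [mu [c [fae pres [Z [mZ Z0 sat]] cP]]].
have aZ := fae_measurable fae mZ.
have muZ : mu Z = 0 by apply/eqP; rewrite -eqe (fae_extends fae mZ) Z0.
have muE s : uniq (unzip1 s) -> alg (cyl s) /\ mu (cyl s) = (2^-1) ^+ size s.
  move=> us; split; first by apply: (fae_measurable fae); exact: measurable_cyl.
  apply/eqP; rewrite -eqe (fae_extends fae (measurable_cyl s)).
  by rewrite (fair_coin_uniq hm).
have T5 x : iter 5 (coord_shift tau^-1%g) x = x.
  by rewrite iter_coord_shift tauV_expg5 coord_shift1.
have eE : [set x : borel_shift_space G25 | ~~ x 1%g] = cyl [:: (1%g, false)].
  by apply/seteqP; split=> x; rewrite /cyl /= andbT eqbF_neg.
have [aE mE] := muE [:: (1%g, false)] isT.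
have uW : uniq (unzip1 [seq ((tau^-1 ^+ j)%g, false) | j <- iota 0 5]).
  by rewrite /unzip1 -map_comp; exact: uniq_tau_powers.
have [_ mW] := muE _ uW.
have rule x : ~ Z x -> c x = c (coord_shift tau^-1%g x) +
    [|| x 1%g, c (coord_shift tau^-1%g x) == 0 |
     c (coord_shift sigma x) == 1]%:R.
  move=> nZx; have /contrapT /= := contra_not (sat x) nZx.
  rewrite (_ : 5%:R = 0 :> 'Z_5); last exact/val_inj.
  by case: ifP => _ /= ->; rewrite ?addr0.
have aE' : alg [set x : borel_shift_space G25 | ~~ x 1%g] by rewrite eE.
have := advance_bound fae (pres ord0) (pres ord_max) T5 aE' cP aZ muZ rule.
(* The coordinate at the identity of the [j]-th iterate is the coordinate of [x] at [tau^-1 ^+ j],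
   so [W] is a cylinder. *)
rewrite eE (_ : [set x | forall j, _] =
  cyl [seq ((tau^-1 ^+ j)%g, false) | j <- iota 0 5]); last first.
  apply/seteqP; split=> x.
    move=> xW; apply/allP => _ /mapP[j /xW + ->].
    by rewrite /cyl /= andbT iter_coord_shift /coord_shift mul1g.
  move=> /allP xW j j5; have := xW _ (map_f _ j5).
  by rewrite /cyl /= andbT iter_coord_shift /coord_shift mul1g.
(* The bound now reads 1/2 <= 2/5 + 2/32 = 37/80, a contradiction. *)
by rewrite mE mW /= !exprS expr0 !mulr1; lra.
Qed.
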